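(* Let $S\subseteq V(K)$ be an ERR:LD set for the infinite king grid $K$. Then the average share of the vertices in $S$ is at most $\frac{38}{15}$.
   Context: The infinite king grid $K$ has vertex set $\mathbb{Z}^2$, with distinct vertices $(a,b),(c,d)$ adjacent iff $\max(|a-c|,|b-d|)=1$. $N(v)$ is the open neighborhood of $v$ and $N[v]=N(v)\cup\{v\}$. A set $S\subseteq V(K)$ is an ERR:LD (error-correcting locating-dominating) set iff (i) for all $v\in V(K)$, $|N[v]\cap S|\ge 3$; (ii) for all distinct $u,v\in S$, $|((N(v)\cap S)\triangle(N(u)\cap S))\setminus\{v,u\}|\ge 1$; (iii) for all $v\in V(K)\setminus S$ and $u\in S$, $|((N(v)\cap S)\triangle(N(u)\cap S))\setminus\{u\}|\ge 2$; (iv) for all distinct $u,v\in V(K)\setminus S$, $|(N(v)\cap S)\triangle(N(u)\cap S)|\ge 3$. For $v\in V(K)$, $dom(v)=|N[v]\cap S|$; the share of a detector $x\in S$ is $sh(x)=\sum_{u\in N[x]}\frac{1}{dom(u)}$. The average share of the vertices in $S$ is $\limsup_{n\to\infty}\frac{1}{|S\cap Q_n|}\sum_{x\in S\cap Q_n} sh(x)$, where $Q_n=\{-n,\dots,n\}^2$; it equals the reciprocal of the density of $S$. *)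

(* Defs.v *)
From HB Require Import structures.
From mathcomp Require Import all_boot all_order all_algebra.
From mathcomp Require Import finmap.
From mathcomp Require Import all_classical all_reals all_analysis.
From mathcomp Require Import zify.

Set Implicit Arguments.
Unset Strict Implicit.
Unset Printing Implicit Defensive.

Import Order.TTheory GRing.Theory Num.Theory.

Local Open Scope classical_set_scope.
Local Open Scope ring_scope.

Definition vertex : Type := (int * int)%type.

Definition adj (u v : vertex) : Prop :=
  u <> v /\ Num.max `|u.1 - v.1| `|u.2 - v.2| = 1.

Definition nbhd_open (v : vertex) : set vertex := [set u | adj v u].

Definition nbhd_closed (v : vertex) : set vertex := nbhd_open v `|` [set v].

(* [fset_set] is the empty finite set on infinite arguments; [card] is only
   applied to subsets of neighborhoods and of boxes, which are finite by
   [finite_nbhd_closed] and [finite_box] below. *)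
Definition card (A : set vertex) : nat := #|` fset_set A|.

Record err_ld (S : set vertex) : Prop := ErrLD {
  err_ld_dom : forall v : vertex, (3 <= card (nbhd_closed v `&` S))%N ;
  err_ld_in_in : forall u v : vertex, S u -> S v -> u <> v ->
    (1 <= card (((nbhd_open v `&` S) `+` (nbhd_open u `&` S)) `\` [set v; u]))%N ;
  err_ld_out_in : forall v u : vertex, ~ S v -> S u ->
    (2 <= card (((nbhd_open v `&` S) `+` (nbhd_open u `&` S)) `\` [set u]))%N ;
  err_ld_out_out : forall u v : vertex, ~ S u -> ~ S v -> u <> v ->
    (3 <= card ((nbhd_open v `&` S) `+` (nbhd_open u `&` S)))%N
}.

Definition dom (S : set vertex) (v : vertex) : nat := card (nbhd_closed v `&` S).

Definition share (R : realType) (S : set vertex) (x : vertex) : R :=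
  \sum_(u \in nbhd_closed x) (((dom S u)%:R)^-1 : R).

Definition box (n : nat) : set vertex :=
  [set v | - n%:Z <= v.1 <= n%:Z /\ - n%:Z <= v.2 <= n%:Z].

(* When [S `&` box n] is empty the quotient is 0; if [err_ld S] holds this can
   happen only for n = 0, so it does not affect the limit superior. *)
Definition share_mean (R : realType) (S : set vertex) (n : nat) : R :=
  ((card (S `&` box n))%:R)^-1 * \sum_(x \in S `&` box n) share R S x.

Definition average_share (R : realType) (S : set vertex) : \bar R :=
  limn_esup (fun n => (share_mean R S n)%:E).

Lemma finite_int_itv (a b : int) : finite_set [set x : int | a <= x <= b].
Proof.
apply: (sub_finite_set _ (finite_image (fun k : nat => a + k%:Z)
  (finite_II `|b - a|.+1))) => x /= /andP[ax xb].
by exists `|x - a|%N => /=; lia.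
Qed.

Lemma finite_box n : finite_set (box n).
Proof.
exact: (finite_setX (finite_int_itv (- n%:Z) n) (finite_int_itv (- n%:Z) n)).
Qed.

Lemma finite_nbhd_closed v : finite_set (nbhd_closed v).
Proof.
apply: (sub_finite_set _ (finite_setX (finite_int_itv (v.1 - 1) (v.1 + 1))
  (finite_int_itv (v.2 - 1) (v.2 + 1)))) => u /= [[_]|->]; split => /=; lia.
Qed.

(* Main.v *)
From Stdlib Require Import NArith.
Require Import Defs.
From mathcomp Require Import all_boot all_order all_algebra.
From mathcomp Require Import finmap.
From mathcomp Require Import all_classical all_reals all_analysis.
From mathcomp Require Import zify ring lra.

(** The shares of the detectors in a box add up to the number of vertices of the box,
    up to a boundary term, so the claim is that [S] has lower density at least 15/38.
    Let every vertex [u] split one unit among the detectors of its closed neighborhood,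
    not evenly but in proportion to weights: 3 for an orthogonal and 4 for a diagonal
    neighbor if [u] is not a detector; 11 for [u] itself, 15 for an orthogonal and 10
    for a diagonal neighbor if it is one.  With these weights, unlike with the even
    split that defines the share, every single detector receives at most 38/15, so no
    discharging is needed.  What a detector receives depends on the 5x5 window around
    it, and the windows are checked exhaustively: bounding the contributions of the
    three rows of neighbors separately suffices unless the middle three rows of the
    window are exceptional.  The four axioms enter only through the fact that [S]
    meets every closed neighborhood, and for [u <> v] every set consisting of [u], [v]
    and the vertices adjacent to exactly one of them, at least three times. *)

Set Implicit Arguments.
Unset Strict Implicit.
Unset Printing Implicit Defensive.

Import Order.TTheory GRing.Theory Num.Theory.

(** * The window check *)

Definition cell : Type := (nat * nat)%type.
Definition window : Type := seq (seq bool).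

Definition lit (w : window) (p : cell) : bool := nth false (nth [::] w p.1) p.2.

Definition kadj (p q : cell) : bool :=
  [&& p != q, p.1 <= q.1.+1, q.1 <= p.1.+1, p.2 <= q.2.+1 & q.2 <= p.2.+1].

Definition cells : seq cell := [seq (i, j) | i <- iota 0 5, j <- iota 0 5].

Definition disk (p : cell) : seq cell := [seq z <- cells | (z == p) || kadj p z].

Definition separator (p q : cell) : seq cell :=
  [seq z <- cells | [|| kadj p z (+) kadj q z, z == p | z == q]].

Arguments disk : simpl never.
Arguments separator : simpl never.

Definition hit (w : window) (l : seq cell) : bool := 3 <= count (lit w) l.

(** Grouped by the number of window rows they reach: three here, four in [cross_sets], all five in
    [column_set]. Partial windows can thus be discarded early. *)
Definition row_sets : seq (seq cell) :=
  [:: disk (1, 1); disk (1, 2); disk (1, 3);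
      separator (1, 1) (1, 2); separator (1, 2) (1, 3); separator (1, 1) (1, 3)].

Definition cross_sets : seq (seq cell) :=
  [:: separator (1, 1) (2, 1); separator (1, 2) (2, 2); separator (1, 3) (2, 3);
      separator (1, 1) (2, 2); separator (1, 2) (2, 1);
      separator (1, 2) (2, 3); separator (1, 3) (2, 2)].

Definition column_set : seq cell := separator (1, 2) (3, 2).

(* Orthogonal and diagonal neighbors are at [k = 1] and [k = 2], the vertex itself
   at [k = 0].  The weights come from a numerical search. *)
Definition weight (s : bool) (k : nat) : nat :=
  nth 0 (if s then [:: 11; 15; 10] else [:: 0; 3; 4]) k.

(* The unit is [1200], so that [38/15] becomes [3040]; amounts are rounded up. *)
Definition wshare (k : nat) (s : bool) (o d : nat) : N :=
  let W := N.of_nat (weight s 0 + o * weight s 1 + d * weight s 2) in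
  N.div (N.add (N.mul 1200 (N.of_nat (weight s k))) (N.pred W)) W.

Definition orth (p : cell) : seq cell :=
  let: (i, j) := p in [:: (i.-1, j); (i.+1, j); (i, j.-1); (i, j.+1)].
Definition diag (p : cell) : seq cell :=
  let: (i, j) := p in [:: (i.-1, j.-1); (i.-1, j.+1); (i.+1, j.-1); (i.+1, j.+1)].

Definition cell_wshare (w : window) (k : nat) (p : cell) : N :=
  wshare k (lit w p) (count (lit w) (orth p)) (count (lit w) (diag p)).

(** What a neighbor passes on depends only on its own row and the two rows next to it. The detector
    sits in column 2 of [c] here, of [b] in [mid_wshare]. *)
Definition side_wshare (a b c : seq bool) : N :=
  let w := [:: a; b; c] in
  N.add (cell_wshare w 2 (1, 1)) (N.add (cell_wshare w 1 (1, 2)) (cell_wshare w 2 (1, 3))).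
Definition mid_wshare (a b c : seq bool) : N :=
  let w := [:: a; b; c] in
  N.add (cell_wshare w 1 (1, 1)) (N.add (cell_wshare w 0 (1, 2)) (cell_wshare w 1 (1, 3))).

Definition row_ok (a b c : seq bool) : bool := all (hit [:: a; b; c]) row_sets.
Definition cross_ok (a b c d : seq bool) : bool := all (hit [:: a; b; c; d]) cross_sets.

Definition rows : seq (seq bool) := Eval compute in
  foldr (fun _ l => [seq b :: r | b <- [:: false; true], r <- l]) [:: [::]] (iota 0 5).

Definition max_wshare (l : seq (seq bool * N)) : N :=
  foldr (fun t m => N.max t.2 m) N0 l.

Definition sides (b c : seq bool) : seq (seq bool * N) :=
  [seq (a, side_wshare a b c) | a <- rows & row_ok a b c].

(* [b], [c], [d] are the middle rows, [c] through the detector; [top] and [bot] list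
   the candidates for the outer rows with the amounts passed on by the rows [b], [d]. *)
Definition check_sides (b c d : seq bool) (m : N) (top bot : seq (seq bool * N)) : bool :=
  if N.leb (N.add (max_wshare top) (N.add m (max_wshare bot))) 3040 then true
  else all (fun t => all (fun t' =>
    if N.leb (N.add t.2 (N.add m t'.2)) 3040 then true
    else ~~ hit [:: t.1; b; c; d; t'.1] column_set) bot) top.

(** Here and in [check_sides] the tests are nested [if]s, not disjunctions, so that call-by-value
    evaluation enters the costly branch only when the cheap bound fails. *)
Definition check_mid (c : seq bool)
    (t t' : seq bool * (seq (seq bool * N) * N)) : bool :=
  let: (b, (top, mt)) := t in let: (d, (bot, mb)) := t' in
  if row_ok b c d then
    let m := mid_wshare b c d in
    if N.leb (N.add mt (N.add m mb)) 3040 then true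
    else check_sides b c d m [seq u <- top | cross_ok u.1 b c d]
           [seq u <- bot | cross_ok u.1 d c b]
  else true.

(** One table per central row serves both sides, because the rows below the detector are read upside
    down. *)
Definition entry (c b : seq bool) : seq bool * (seq (seq bool * N) * N) :=
  let l := sides b c in (b, (l, max_wshare l)).

Definition check_center (c : seq bool) : bool :=
  let tab := [seq entry c b | b <- rows] in
  all (fun t => all (check_mid c t) tab) tab.

Definition check : bool := all check_center [seq c <- rows | nth false c 2].

Lemma check_true : check.
Proof. vm_cast_no_check (erefl true). Qed.

Lemma mem_rows (r : seq bool) : size r = 5 -> r \in rows.
Proof. by case: r => [|[] [|[] [|[] [|[] [|[] []]]]]]. Qed.

Lemma le_max_wshare (l : seq (seq bool * N)) t :
  t \in l -> (t.2 <= max_wshare l)%num.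
Proof.
elim: l => //= u l IH; rewrite inE => /orP[/eqP<-|/IH]; lia.
Qed.

Lemma sides_wshare_le (l l' : seq (seq bool * N)) t t' m M : t \in l -> t' \in l' ->
  (max_wshare l + (m + max_wshare l') <= M)%num -> (t.2 + (m + t'.2) <= M)%num.
Proof. by move=> /le_max_wshare + /le_max_wshare; lia. Qed.

(** Soundness of the check: where a bound by maxima fails, [a] and [e] survive the filters, and a
    pair still above the limit would contradict the hypothesis on [column_set]. *)
Lemma window_wshare_le (a b c d e : seq bool) :
  a \in rows -> b \in rows -> c \in rows -> d \in rows -> e \in rows ->
  nth false c 2 -> row_ok a b c -> row_ok b c d -> row_ok e d c ->
  cross_ok a b c d -> cross_ok e d c b -> hit [:: a; b; c; d; e] column_set ->
  (side_wshare a b c + (mid_wshare b c d + side_wshare e d c) <= 3040)%num.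
Proof.
move=> aR bR cR dR eR c2 abc bcd edc abcd edcb col.
have := check_true; rewrite /check => /allP/(_ c); rewrite mem_filter c2 cR => /(_ isT).
rewrite /check_center => /allP/(_ _ (map_f _ bR))/allP/(_ _ (map_f _ dR)).
rewrite /check_mid /entry bcd.
have inS r r' : r \in rows -> row_ok r r' c -> (r, side_wshare r r' c) \in sides r' c.
  by move=> rR rok; apply/mapP; exists r => //; rewrite mem_filter rok.
have atop := inS _ _ aR abc; have ebot := inS _ _ eR edc.
case: N.leb_spec => [le_max _|_]; first exact: sides_wshare_le atop ebot le_max.
rewrite /check_sides; set top := [seq u <- _ | _]; set bot := [seq u <- _ | _].
have {}atop : (a, side_wshare a b c) \in top by rewrite mem_filter abcd.
have {}ebot : (e, side_wshare e d c) \in bot by rewrite mem_filter edcb.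
case: N.leb_spec => [le_max _|_]; first exact: sides_wshare_le atop ebot le_max.
move=> /allP/(_ _ atop)/allP/(_ _ ebot).
by case: N.leb_spec => [//|_]; rewrite col.
Qed.

(** Amounts are rounded up, so a vertex with a detector in reach hands out at least its full unit;
    only 50 cases arise. *)
Lemma wshare_total (s : bool) (o d : nat) : o <= 4 -> d <= 4 -> 0 < s + o + d ->
  1200 <= s * N.to_nat (wshare 0 s o d) + o * N.to_nat (wshare 1 s o d)
          + d * N.to_nat (wshare 2 s o d).
Proof.
have chk : all (fun s : bool => all (fun o => all (fun d => (0 < s + o + d) ==>
    N.leb 1200 (N.of_nat s * wshare 0 s o d + N.of_nat o * wshare 1 s o d
                + N.of_nat d * wshare 2 s o d)%num) (iota 0 5)) (iota 0 5)) [:: false; true].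
  by vm_compute.
move=> o4 d4 sod.
have sB : s \in [:: false; true] by case: s {sod}.
have oI : o \in iota 0 5 by rewrite mem_iota.
have dI : d \in iota 0 5 by rewrite mem_iota.
move: chk => /allP/(_ _ sB)/allP/(_ _ oI)/allP/(_ _ dI)/implyP/(_ sod)/N.leb_le.
move: (wshare 0 s o d) (wshare 1 s o d) (wshare 2 s o d) => w0 w1 w2.
by clear; lia.
Qed.

Local Open Scope classical_set_scope.
Local Open Scope ring_scope.

(** * Windows of an error-correcting locating-dominating set *)

Lemma card_le_size (A : set vertex) (l : seq vertex) :
  (forall z, A z -> z \in l) -> (Defs.card A <= size l)%N.
Proof.
move=> Al; have finA : finite_set A.
  by apply: sub_finite_set (finite_seq l) => z /Al.
rewrite /Defs.card (leq_trans _ (size_undup l))// -card_fseq.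
apply/fsubset_leq_card/fsubsetP => z; rewrite in_fset_set// inE => /Al zl.
by rewrite inE.
Qed.

Lemma card_eq_size (A : set vertex) (l : seq vertex) : uniq l ->
  (forall z, A z <-> z \in l) -> Defs.card A = size l.
Proof.
move=> ul Al; rewrite /Defs.card -(undup_id ul) -card_fseq; congr #|` _|.
have -> : A = [set` [fset z in l]%fset].
  by apply/seteqP; split=> z /=; rewrite inE /= => /Al.
by rewrite set_fsetK.
Qed.

Lemma adjP (u v : vertex) :
  adj u v <-> [/\ u != v, `|u.1 - v.1| <= 1 & `|u.2 - v.2| <= 1].
Proof.
case: u v => [a b] [c d]; rewrite /adj xpair_eqE /=; split.
  by move=> [/eqP]; rewrite xpair_eqE; split => //; lia.
move=> [ne h1 h2]; split; first by apply/eqP; rewrite xpair_eqE.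
lia.
Qed.


(** The closed neighborhood of such a cell stays inside the first [n] rows, so a view of [n] rows
    decides the sets built from it. *)
Definition interior (n : nat) (p : cell) : bool :=
  [&& (0 < p.1)%N, (p.1.+1 < n)%N, (0 < p.2)%N & (p.2.+1 < 5)%N].

Lemma all_row_sets (P : pred (seq cell)) :
  (forall p, interior 3 p -> P (disk p)) ->
  (forall p q, interior 3 p -> interior 3 q -> p != q -> P (separator p q)) ->
  all P row_sets.
Proof.
move=> D E; do 3![apply/andP; split; first exact: D].
by do 3![apply/andP; split; first exact: E].
Qed.

Lemma all_cross_sets (P : pred (seq cell)) :
  (forall p q, interior 4 p -> interior 4 q -> p != q -> P (separator p q)) ->
  all P cross_sets.
Proof. by move=> E; do 7![apply/andP; split; first exact: E]. Qed.

Definition mark (S : set vertex) (z : vertex) : bool := `[< S z >].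

Section Windows.
Variable S : set vertex.
Hypothesis hS : err_ld S.

Local Notation s := (mark S).

Lemma card_le_count (A : set vertex) (l : seq vertex) :
  (forall z, A z -> z \in l /\ S z) -> (Defs.card A <= count s l)%N.
Proof.
move=> Al; rewrite -size_filter; apply: card_le_size => z /Al[zl Sz].
by rewrite mem_filter zl andbT; apply/asboolP.
Qed.

Lemma disk_ge3 (v : vertex) (l : seq vertex) :
  (forall z, nbhd_closed v z -> z \in l) -> (3 <= count s l)%N.
Proof.
move=> vl; apply: leq_trans (err_ld_dom hS v) _.
by apply: card_le_count => z [/vl].
Qed.

(* The three separation axioms merge into one: a set containing [u], [v] and
   every vertex adjacent to exactly one of them meets [S] three times. *)
Lemma separator_ge3 (u v : vertex) (l : seq vertex) : u <> v -> uniq l ->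
  u \in l -> v \in l -> (forall z, (nbhd_open u `+` nbhd_open v) z -> z \in l) ->
  (3 <= count s l)%N.
Proof.
move=> uv ul ul' vl hl.
have vl' : v \in rem u l by rewrite mem_rem_uniq// inE vl andbT; apply/eqP => /esym.
(* Each of [u], [v] outside [S] lowers this count by one and raises the threshold of the applicable
   axiom by one, so the total is always at least 3. *)
have eql : count s l = (s u + (s v + count s (rem v (rem u l))))%N.
  by rewrite (permP (perm_to_rem ul')) /= (permP (perm_to_rem vl')).
have rl z : z <> u -> z <> v -> (nbhd_open u `+` nbhd_open v) z ->
    z \in rem v (rem u l).
  move=> zu zv /hl zl; rewrite mem_rem_uniq ?rem_uniq// inE mem_rem_uniq// inE zl.
  by rewrite andbT; apply/andP; split; apply/eqP.
have sub z : ((nbhd_open v `&` S) `+` (nbhd_open u `&` S)) z ->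
    S z /\ (nbhd_open u `+` nbhd_open v) z.
  rewrite /setY /= => -[[[az Sz] nz]|[[az Sz] nz]]; split => //.
    by right; split => // uz; apply: nz.
  by left; split => // uz; apply: nz.
rewrite eql; case: (pselect (S u)) (pselect (S v)) => [Su|Su] [Sv|Sv].
- rewrite /mark !asboolT// !add1n !ltnS; apply: leq_trans (err_ld_in_in hS Su Sv uv) _.
  apply: card_le_count => z [/sub[Sz hz] /= zuv]; split => //.
  by apply: rl => // ?; apply: zuv; [right|left].
- rewrite /mark asboolT// asboolF// add1n add0n ltnS.
  apply: leq_trans (err_ld_out_in hS Sv Su) _.
  apply: card_le_count => z [/sub[Sz hz] /= zuv]; split => //.
  by apply: rl => // zv; apply: Sv; rewrite -zv.
- rewrite /mark asboolF// asboolT// add1n add0n ltnS.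
  have := err_ld_out_in hS Su Sv; rewrite setYC => /leq_trans; apply.
  apply: card_le_count => z [/sub[Sz hz] /= zuv]; split => //.
  by apply: rl => // zu; apply: Su; rewrite -zu.
- rewrite /mark !asboolF// !add0n.
  apply: leq_trans (err_ld_out_out hS Su Sv uv) _.
  apply: card_le_count => z /sub[Sz hz]; split => //.
  by apply: rl => // zu; [apply: Su|apply: Sv]; rewrite -zu.
Qed.

(* [place o sg] lays the grid of cells over the king grid with corner [o], the
   rows running upwards or downwards according to the sign [sg]. *)
Definition place (o : vertex) (sg : int) (p : cell) : vertex :=
  (o.1 + sg * p.1%:Z, o.2 + p.2%:Z).

Definition view (o : vertex) (sg : int) (n : nat) : window :=
  mkseq (fun i => mkseq (fun j => s (place o sg (i, j))) 5) n.

Lemma lit_view o sg n (p : cell) : (p.1 < n)%N -> (p.2 < 5)%N ->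
  lit (view o sg n) p = s (place o sg p).
Proof. by case: p => i j /= hi hj; rewrite /lit !nth_mkseq. Qed.

Lemma place_inj o sg : sg = 1 \/ sg = -1 -> injective (place o sg).
Proof. by move=> hs [i j] [i' j'] [h1 h2]; congr (_, _); nia. Qed.

Lemma adj_place o sg p q : sg = 1 \/ sg = -1 ->
  adj (place o sg p) (place o sg q) <-> kadj p q.
Proof.
move=> hs; rewrite adjP /kadj (inj_eq (place_inj hs)).
case: p q => [i j] [i' j'] /=; split.
  by move=> [-> h1 h2]; apply/and5P; split => //; nia.
by move=> /and5P[-> h1 h2 h3 h4]; split => //; nia.
Qed.

Lemma adj_place_ex o sg n p z : sg = 1 \/ sg = -1 -> (n <= 5)%N ->
  (0 < p.1)%N -> (p.1.+1 < n)%N -> (0 < p.2)%N -> (p.2.+1 < 5)%N ->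
  adj (place o sg p) z -> exists q, [/\ (q.1 < n)%N, (q.2 < 5)%N & z = place o sg q].
Proof.
move=> hs n5 p1 p1n p2 p2n /adjP[_ h1 h2].
(* Whichever way the rows run, the row index is the distance from the corner. *)
exists (`|z.1 - o.1|%N, `|z.2 - o.2|%N).
case: p z o {n5} p1 p1n p2 p2n h1 h2 => [i j] [a b] [a' b'] /= p1 p1n p2 p2n h1 h2.
by case: hs h1 => -> h1; split => /=; rewrite /place /=;
  [lia|lia|congr (_, _); lia|lia|lia|congr (_, _); lia].
Qed.

Section Rows.
Variables (o : vertex) (sg : int) (n : nat).
Hypotheses (hsg : sg = 1 \/ sg = -1) (n5 : (n <= 5)%N).

Lemma mem_cells (q : cell) : (q \in cells) = (q.1 < 5)%N && (q.2 < 5)%N.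
Proof.
case: q => i j; apply/allpairsP/andP => [[[a b] []]|[i5 j5]].
  by rewrite !mem_iota => ? ? [-> ->].
by exists (i, j); rewrite !mem_iota.
Qed.

Lemma uniq_cells : uniq cells.
Proof. by []. Qed.

Lemma hit_view (l : seq cell) : {in l, forall q, (q.1 < n)%N && (q.2 < 5)%N} ->
  (3 <= count s (map (place o sg) l))%N -> hit (view o sg n) l.
Proof.
move=> hl; rewrite count_map /hit => /leq_trans; apply; apply: eq_leq.
by apply: eq_in_count => q /hl/andP[q1 q2] /=; rewrite lit_view.
Qed.

Lemma kadj_interior p q : interior n p -> kadj p q || (q == p) ->
  (q.1 < n)%N && (q.2 < 5)%N.
Proof.
move=> /and4P[p1 p1n p2 p2n] /orP[/and5P[_ h1 h2 h3 h4]|/eqP->]; lia.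
Qed.

Lemma hit_disk p : interior n p -> hit (view o sg n) (disk p).
Proof.
move=> pI; apply: hit_view => [q|].
  by rewrite mem_filter orbC => /andP[/(kadj_interior pI)].
have /and4P[p1 p1n p2 p2n] := pI.
apply: (@disk_ge3 (place o sg p)) => z [az|->]; last first.
  by apply: map_f; rewrite mem_filter eqxx mem_cells; lia.
have [q [q1 q2 zq]] := adj_place_ex hsg n5 p1 p1n p2 p2n az.
rewrite zq; apply: map_f; rewrite mem_filter mem_cells q2 (leq_trans q1)// !andbT.
by apply/orP; right; apply/(adj_place o _ _ hsg); rewrite -zq.
Qed.

(** Both cells being interior, every vertex adjacent to exactly one of their places is itself the
    place of a cell, as [separator_ge3] requires. *)
Lemma hit_separator p q : interior n p -> interior n q -> p != q ->
  hit (view o sg n) (separator p q).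
Proof.
move=> pI qI pq; apply: hit_view => [z|].
  rewrite mem_filter => /andP[+ _].
  case/or3P => [|/eqP->|/eqP->]; last 2 first.
  - by apply: (kadj_interior pI); rewrite eqxx orbT.
  - by apply: (kadj_interior qI); rewrite eqxx orbT.
  case: (boolP (kadj p z)) => [pz _|_ /= qz].
    by apply: (kadj_interior pI); rewrite pz.
  by apply: (kadj_interior qI); rewrite qz.
have cellP r : interior n r -> r \in cells.
  by move=> /and4P[*]; rewrite mem_cells; lia.
apply: (@separator_ge3 (place o sg p) (place o sg q)).
- by move=> /(place_inj hsg)/eqP; rewrite (negPf pq).
- by rewrite (map_inj_uniq (place_inj hsg)) filter_uniq// uniq_cells.
- by apply: map_f; rewrite mem_filter eqxx orbT cellP.
- by apply: map_f; rewrite mem_filter eqxx !orbT cellP.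
have toZ r z : interior n r -> adj (place o sg r) z ->
    exists2 q', q' \in cells & z = place o sg q'.
  move=> /and4P[p1 p1n p2 p2n] az.
  have [q' [q1 q2 zq]] := adj_place_ex hsg n5 p1 p1n p2 p2n az.
  by exists q' => //; rewrite mem_cells q2 (leq_trans q1).
move=> z; rewrite /setY /nbhd_open /= => -[] [az naz].
  have [q' q'c zq'] := toZ _ _ pI az; rewrite zq'; apply: map_f.
  rewrite zq' in az naz; rewrite mem_filter q'c.
  by move: az naz => /(adj_place o _ _ hsg)-> /(adj_place o _ _ hsg)/negP/negPf->.
have [q' q'c zq'] := toZ _ _ qI az; rewrite zq'; apply: map_f.
rewrite zq' in az naz; rewrite mem_filter q'c.
by move: az naz => /(adj_place o _ _ hsg)-> /(adj_place o _ _ hsg)/negP/negPf->.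
Qed.

End Rows.

(** * The amount that a single detector receives *)

Definition orth_nb (u : vertex) : seq vertex :=
  [:: (u.1 - 1, u.2); (u.1 + 1, u.2); (u.1, u.2 - 1); (u.1, u.2 + 1)].
Definition diag_nb (u : vertex) : seq vertex :=
  [:: (u.1 - 1, u.2 - 1); (u.1 - 1, u.2 + 1); (u.1 + 1, u.2 - 1); (u.1 + 1, u.2 + 1)].

Definition vertex_wshare (k : nat) (u : vertex) : nat :=
  N.to_nat (wshare k (s u) (count s (orth_nb u)) (count s (diag_nb u))).

Lemma cell_wshare_view o sg n k p : sg = 1 \/ sg = -1 -> interior n p ->
  N.to_nat (cell_wshare (view o sg n) k p) = vertex_wshare k (place o sg p).
Proof.
case: p => i j hsg /and4P[/= p1 p1n p2 p2n].
rewrite /cell_wshare /vertex_wshare /= !lit_view //=; try lia.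
have eN : o.1 + sg * i.-1%:Z = o.1 + sg * i%:Z - sg by nia.
have eS : o.1 + sg * i.+1%:Z = o.1 + sg * i%:Z + sg by nia.
have eW : o.2 + j.-1%:Z = o.2 + j%:Z - 1 by lia.
have eE : o.2 + j.+1%:Z = o.2 + j%:Z + 1 by lia.
rewrite /place /= eN eS eW eE; case: hsg => ->; first by [].
(* In the reflected grid the upper and lower neighbors trade places, which only reorders the two
   counts. *)
by rewrite opprK !addn0; congr (N.to_nat (wshare _ _ _ _));
  [rewrite addnCA|rewrite addnA addnC -addnA].
Qed.

Definition row (x : vertex) (i : int) : seq bool :=
  mkseq (fun j => s (x.1 + i, x.2 - 2 + j%:Z)) 5.

Lemma view_rows x c sg n (l : seq int) :
  l = mkseq (fun i => c + sg * i%:Z) n ->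
  view (x.1 + c, x.2 - 2) sg n = [seq row x i | i <- l].
Proof.
move=> ->; rewrite -map_comp; apply: eq_mkseq => i; apply: eq_mkseq => j /=.
by rewrite /place /= addrA.
Qed.

(** The window around [x] is read from row -2 upwards and from row 2 downwards, so both halves meet
    the same conditions; a third view is centered at [x]. *)
Lemma received_le x : S x ->
  (vertex_wshare 0 x + \sum_(u <- orth_nb x) vertex_wshare 1 u
   + \sum_(u <- diag_nb x) vertex_wshare 2 u <= 3040)%N.
Proof.
move=> Sx.
have p1 : (1 : int) = 1 \/ (1 : int) = -1 by left.
have n1 : (-1 : int) = 1 \/ (-1 : int) = -1 by right.
have t1 : place (x.1 - 2, x.2 - 2) 1 (1, 1)%N = (x.1 - 1, x.2 - 1)
  by congr (_, _) => /=; lia.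
have t2 : place (x.1 - 2, x.2 - 2) 1 (1, 2)%N = (x.1 - 1, x.2)
  by congr (_, _) => /=; lia.
have t3 : place (x.1 - 2, x.2 - 2) 1 (1, 3)%N = (x.1 - 1, x.2 + 1)
  by congr (_, _) => /=; lia.
have m1 : place (x.1 - 1, x.2 - 2) 1 (1, 1)%N = (x.1, x.2 - 1)
  by congr (_, _) => /=; lia.
have m2 : place (x.1 - 1, x.2 - 2) 1 (1, 2)%N = (x.1, x.2)
  by congr (_, _) => /=; lia.
have m3 : place (x.1 - 1, x.2 - 2) 1 (1, 3)%N = (x.1, x.2 + 1)
  by congr (_, _) => /=; lia.
have b1 : place (x.1 + 2, x.2 - 2) (-1) (1, 1)%N = (x.1 + 1, x.2 - 1)
  by congr (_, _) => /=; lia.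
have b2 : place (x.1 + 2, x.2 - 2) (-1) (1, 2)%N = (x.1 + 1, x.2)
  by congr (_, _) => /=; lia.
have b3 : place (x.1 + 2, x.2 - 2) (-1) (1, 3)%N = (x.1 + 1, x.2 + 1)
  by congr (_, _) => /=; lia.
have v3 : view (x.1 - 2, x.2 - 2) 1 3 = [:: row x (-2); row x (-1); row x 0]
  by apply: (@view_rows x _ _ _ [:: -2; -1; 0]).
have v4 : view (x.1 - 2, x.2 - 2) 1 4 = [:: row x (-2); row x (-1); row x 0; row x 1]
  by apply: (@view_rows x _ _ _ [:: -2; -1; 0; 1]).
have v5 : view (x.1 - 2, x.2 - 2) 1 5 = [:: row x (-2); row x (-1); row x 0; row x 1; row x 2]
  by apply: (@view_rows x _ _ _ [:: -2; -1; 0; 1; 2]).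
have vm : view (x.1 - 1, x.2 - 2) 1 3 = [:: row x (-1); row x 0; row x 1]
  by apply: (@view_rows x _ _ _ [:: -1; 0; 1]).
have w3 : view (x.1 + 2, x.2 - 2) (-1) 3 = [:: row x 2; row x 1; row x 0]
  by apply: (@view_rows x _ _ _ [:: 2; 1; 0]).
have w4 : view (x.1 + 2, x.2 - 2) (-1) 4 = [:: row x 2; row x 1; row x 0; row x (-1)]
  by apply: (@view_rows x _ _ _ [:: 2; 1; 0; -1]).
have rR i : row x i \in rows by apply: mem_rows; rewrite size_mkseq.
have rowok o sg : sg = 1 \/ sg = -1 -> all (hit (view o sg 3)) row_sets.
  by move=> hsg; apply: all_row_sets => [p|p q]; [exact: hit_disk|exact: hit_separator].
have crossok o sg : sg = 1 \/ sg = -1 -> all (hit (view o sg 4)) cross_sets.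
  by move=> hsg; apply: all_cross_sets => p q; exact: hit_separator.
have ok3 := rowok (x.1 - 2, x.2 - 2) _ p1; rewrite v3 in ok3.
have okm := rowok (x.1 - 1, x.2 - 2) _ p1; rewrite vm in okm.
have ok3' := rowok (x.1 + 2, x.2 - 2) _ n1; rewrite w3 in ok3'.
have ok4 := crossok (x.1 - 2, x.2 - 2) _ p1; rewrite v4 in ok4.
have ok4' := crossok (x.1 + 2, x.2 - 2) _ n1; rewrite w4 in ok4'.
have ok5 := @hit_separator (x.1 - 2, x.2 - 2) _ 5 p1 isT (1, 2)%N (3, 2)%N isT isT isT.
rewrite v5 in ok5.
have c2 : nth false (row x 0) 2.
  by rewrite nth_mkseq// /mark addr0 subrK -surjective_pairing; apply/asboolP.
have := window_wshare_le (rR _) (rR _) (rR _) (rR _) (rR _) c2 ok3 okm ok3' ok4 ok4' ok5.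
rewrite /side_wshare /mid_wshare -v3 -vm -w3 => le3040.
have to_nat a a' a'' c c' c'' d d' d'' :
    (a + (a' + a'') + ((c + (c' + c'')) + (d + (d' + d''))) <= 3040)%num ->
    (N.to_nat a + N.to_nat a' + N.to_nat a'' + (N.to_nat c + N.to_nat c' + N.to_nat c'')
     + (N.to_nat d + N.to_nat d' + N.to_nat d'') <= 3040)%N.
  by clear; lia.
have {}le3040 := to_nat _ _ _ _ _ _ _ _ _ le3040.
move: le3040; rewrite !cell_wshare_view// t1 t2 t3 m1 m2 m3 b1 b2 b3 -surjective_pairing.
rewrite !big_cons !big_nil /=; clear; lia.
Qed.
End Windows.

(** * Double counting *)

Definition int_range (n : nat) : seq int := [seq k%:Z - n%:Z | k <- iota 0 n.*2.+1].

Definition box_seq (n : nat) : seq vertex :=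
  [seq (i, j) | i <- int_range n, j <- int_range n].

Lemma mem_int_range n (z : int) : (z \in int_range n) = (- n%:Z <= z <= n%:Z).
Proof.
apply/mapP/idP => [[k + ->]|hz]; first by rewrite mem_iota; lia.
by exists (absz (z + n%:Z)); rewrite ?mem_iota; lia.
Qed.

Lemma mem_box_seq n u :
  (u \in box_seq n) = (- n%:Z <= u.1 <= n%:Z) && (- n%:Z <= u.2 <= n%:Z).
Proof.
case: u => i j; rewrite -!mem_int_range /=; apply/allpairsP/andP.
  by move=> [[a b] [/= ? ? [-> ->]]].
by move=> [hi hj]; exists (i, j).
Qed.

Lemma uniq_box_seq n : uniq (box_seq n).
Proof.
have ui : uniq (int_range n) by rewrite map_inj_uniq ?iota_uniq// => a b; lia.
by apply: allpairs_uniq => // -[a b] [c d].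
Qed.

Lemma size_box_seq n : size (box_seq n) = (n.*2.+1 ^ 2)%N.
Proof. by rewrite size_allpairs !size_map size_iota mulnn. Qed.

Definition shift (u d : vertex) : vertex := (u.1 + d.1, u.2 + d.2).
Definition unshift (u d : vertex) : vertex := (u.1 - d.1, u.2 - d.2).

Lemma shiftK d : cancel (shift^~ d) (unshift^~ d).
Proof. by case: d => a b [c e]; rewrite /shift /unshift /= !addrK. Qed.

(* Offsets of the closed neighborhood, tagged by their [l^1] length. *)
Definition offsets : seq (nat * vertex) :=
  [:: (0%N, (0, 0)); (1%N, (-1, 0)); (1%N, (1, 0)); (1%N, (0, -1)); (1%N, (0, 1));
      (2%N, (-1, -1)); (2%N, (-1, 1)); (2%N, (1, -1)); (2%N, (1, 1))].

Lemma ler_sum_subseq (R : numDomainType) (T : eqType) (l l' : seq T) (g : T -> R) :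
  uniq l -> uniq l' -> {subset l <= l'} -> (forall z, 0 <= g z) ->
  \sum_(z <- l) g z <= \sum_(z <- l') g z.
Proof.
move=> ul ul' sub g0.
have /(perm_big _)-> /= : perm_eq l [seq z <- l' | z \in l].
  apply: uniq_perm; rewrite ?filter_uniq// => z; rewrite mem_filter.
  by case: (boolP (z \in l)) => //= /sub.
by rewrite big_filter [leRHS](bigID (mem l)) /= lerDl sumr_ge0.
Qed.

Lemma sum_shift_le (R : numDomainType) n d (g : vertex -> R) :
  (`|d.1| <= 1) && (`|d.2| <= 1) -> (forall z, 0 <= g z) ->
  \sum_(u <- box_seq n) g (shift u d) <= \sum_(u <- box_seq n.+1) g u.
Proof.
move=> hd g0; rewrite -(big_map (shift^~ d) predT g).
apply: ler_sum_subseq; rewrite ?uniq_box_seq//.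
  by rewrite map_inj_uniq ?uniq_box_seq//; apply: can_inj (@shiftK d).
move=> _ /mapP[u + ->]; rewrite !mem_box_seq /shift.
by case: d u hd => a b [c e] /=; lia.
Qed.

(** The exchange common to both double counts: for a fixed offset the sum runs over a translated
    box, which lies in the box one layer larger. *)
Lemma sum_offsets_shift_le (R : numDomainType) n (g : nat * vertex -> vertex -> R) :
  (forall d z, 0 <= g d z) ->
  \sum_(u <- box_seq n) \sum_(d <- offsets) g d (shift u d.2) <=
  \sum_(u <- box_seq n.+1) \sum_(d <- offsets) g d u.
Proof.
move=> g0; rewrite exchange_big [leRHS]exchange_big /= big_seq [leRHS]big_seq.
by apply: ler_sum => d dO; apply: sum_shift_le => //; move: d dO; apply/allP.
Qed.

Definition closed_nb (u : vertex) : seq vertex := [seq shift u d.2 | d <- offsets].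

Lemma closed_nbE u : closed_nb u = u :: orth_nb u ++ diag_nb u.
Proof. by case: u => a b; rewrite /closed_nb /shift /= !addr0. Qed.

Lemma mem_closed_nb u z : z \in closed_nb u <-> nbhd_closed u z.
Proof.
rewrite closed_nbE !inE; case: u z => a b [c e] /=; rewrite !xpair_eqE.
split=> [h|[/adjP[/=]|[-> ->]]]; rewrite ?eqxx ?xpair_eqE //; last lia.
case: (eqVneq (a, b) (c, e)) => [->|ne]; [by right|left].
by apply/adjP; split => //=; lia.
Qed.

Lemma uniq_closed_nb u : uniq (closed_nb u).
Proof.
rewrite /closed_nb (map_comp (shift u) snd) map_inj_uniq//.
by move=> [a b] [c e] [/addrI-> /addrI->].
Qed.

(** Here [2 * m + 1] and [2 * m + 5] are the sides of the boxes of radius [m] and [m + 2], and [c]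
    counts the detectors in the box between them. The areas differ by [16 * m + 24]; 61 is the least
    integer for which the estimate holds at [m = 0]. *)
Lemma mean_le_of_bounds (R : realFieldType) (m c T : R) : 0 <= m ->
  1200 * (2 * m + 1) ^+ 2 <= 3040 * c -> T <= (2 * m + 5) ^+ 2 ->
  c^-1 * T <= 38%:R / 15%:R + 61%:R / (m + 1).
Proof.
move=> m0 lec leT; set q := (m + 1)^-1.
have q0 : 0 < q by rewrite invr_gt0; lra.
have qm : q * (m + 1) = 1 by rewrite mulVf// gt_eqF//; lra.
have c0 : 0 < c.
  have : 1 <= (2 * m + 1) ^+ 2 by rewrite exprn_ege1//; lra.
  lra.
rewrite ler_pdivrMl//; apply: (le_trans leT).
have : 15 / 38 * (2 * m + 1) ^+ 2 * (38 / 15 + 61 * q) <= c * (38 / 15 + 61 * q).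
  by rewrite ler_wpM2r//; lra.
apply: le_trans.
have : 0 <= q * ((2 * m + 1) ^+ 2 * (915 / 38) - (16 * m + 24) * (m + 1)).
  have m2 : 0 <= m ^+ 2 by rewrite exprn_ge0.
  by apply: mulr_ge0; [exact: ltW|move: m0 m2; clear; lra].
have -> : q * ((2 * m + 1) ^+ 2 * (915 / 38) - (16 * m + 24) * (m + 1)) =
    q * (2 * m + 1) ^+ 2 * (915 / 38) - (16 * m + 24) * (q * (m + 1)) by ring.
rewrite qm; lra.
Qed.

Section Counting.
Variables (R : realType) (S : set vertex).
Hypothesis hS : err_ld S.

Local Notation s := (mark S).

Lemma domE u : dom S u = count s (closed_nb u).
Proof.
rewrite -size_filter; apply: card_eq_size; first by rewrite filter_uniq ?uniq_closed_nb.
move=> z; rewrite mem_filter; split=> [[/mem_closed_nb-> /asboolP]|]; first by rewrite andbT.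
by move=> /andP[/asboolP Sz /mem_closed_nb].
Qed.

Lemma dom_gt0 u : (0 < dom S u)%N.
Proof. exact: leq_trans (err_ld_dom hS u). Qed.

Lemma dom_unshift u : dom S u = (\sum_(d <- offsets) s (unshift u d.2))%N.
Proof.
rewrite domE closed_nbE /unshift !big_cons big_nil /= !opprK !subr0 !addn0.
rewrite -surjective_pairing.
(* The offsets are closed under negation; the permutation exchanges each with its opposite. *)
have ac (a b c d e f g h i : nat) :
    (a + (b + (c + (d + (e + (f + (g + (h + i))))))))%N =
    (a + (c + (b + (e + (d + (i + (h + (g + f))))))))%N by clear; lia.
exact: ac.
Qed.

Lemma given_ge u :
  (1200 <= \sum_(d <- offsets) s (shift u d.2) * vertex_wshare S d.1 u)%N.
Proof.
have := dom_gt0 u; rewrite domE closed_nbE -cat1s !count_cat.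
rewrite [count s [:: u]]/= addn0 addnA => pos.
have := @wshare_total (s u) (count s (orth_nb u)) (count s (diag_nb u)).
move=> /(_ (count_size _ _) (count_size _ _) pos) tot.
rewrite !big_cons big_nil /= /shift /= !addr0 !addn0 -surjective_pairing /vertex_wshare.
apply: leq_trans tot _.
move: (wshare 0 _ _ _) (wshare 1 _ _ _) (wshare 2 _ _ _) => w0 w1 w2.
rewrite /= !addn0.
have ac (a b c d e f g h i : nat) x y z :
    (a * x + (b + (c + (d + e))) * y + (f + (g + (h + i))) * z <=
     a * x + (b * y + (c * y + (d * y + (e * y + (f * z + (g * z + (h * z + i * z))))))))%N.
  by clear; lia.
exact: ac.
Qed.

Lemma received_offsets_le x : S x ->
  (\sum_(d <- offsets) vertex_wshare S d.1 (unshift x d.2) <= 3040)%N.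
Proof.
move=> Sx; apply: leq_trans (received_le hS Sx); apply: eq_leq.
rewrite /unshift !big_cons !big_nil /= !opprK !subr0 -surjective_pairing !addn0.
have ac (a b c d e f g h i : nat) :
    (a + (b + (c + (d + (e + (f + (g + (h + i))))))))%N =
    (a + (c + (b + (e + d))) + (i + (h + (g + f))))%N by clear; lia.
exact: ac.
Qed.

(** Every vertex of the smaller box gives at least 1200, all of it to detectors in the larger one,
    and each of these receives at most 3040. *)
Lemma box_le_detectors n :
  1200 * (size (box_seq n))%:R <= 3040 * (count s (box_seq n.+1))%:R :> R.
Proof.
pose g (d : nat * vertex) (x : vertex) : R :=
  (s x * vertex_wshare S d.1 (unshift x d.2))%:R.
have le1 : 1200 * (size (box_seq n))%:R <=
    \sum_(u <- box_seq n) \sum_(d <- offsets) g d (shift u d.2).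
  rewrite -sum1_size natr_sum mulr_sumr.
  apply: ler_sum => u _; rewrite mulr1 /g -natr_sum ler_nat.
  apply: leq_trans (given_ge u) _; apply: eq_leq; apply: eq_bigr => d _.
  by rewrite shiftK.
apply: le_trans le1 _; apply: le_trans (sum_offsets_shift_le n _) _.
  by move=> d z; rewrite /g ler0n.
rewrite -sum1_count natr_sum [X in _ <= _ * X]big_mkcond mulr_sumr; apply: ler_sum => x _.
rewrite /g -natr_sum -big_distrr /= natrM.
case: (boolP (s x)) => [/asboolP Sx|_]; last by rewrite mul0r mulr0.
by rewrite mul1r mulr1 ler_nat received_offsets_le.
Qed.

Lemma mem_detectors n x : (S `&` box n) x <-> x \in [seq x <- box_seq n | s x].
Proof.
rewrite mem_filter mem_box_seq; split=> [[Sx [-> ->]]|/and3P[/asboolP Sx b1 b2]//].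
by rewrite !andbT; apply/asboolP.
Qed.

(** A vertex [u] contributes the inverse of [dom S u] to each of its [dom S u] detectors, hence at
    most one unit to those in the box. *)
Lemma sum_share_le n :
  \sum_(x \in S `&` box n) share R S x <= (size (box_seq n.+1))%:R.
Proof.
have SbE : S `&` box n = [set` [seq x <- box_seq n | s x]].
  by apply/seteqP; split=> x /mem_detectors.
rewrite SbE -fsbig_seq ?filter_uniq ?uniq_box_seq// big_filter big_mkcond.
have shE x : share R S x = \sum_(d <- offsets) ((dom S (shift x d.2))%:R)^-1.
  rewrite /share (_ : nbhd_closed x = [set` closed_nb x]); last first.
    by apply/seteqP; split=> z /= /mem_closed_nb.
  by rewrite -fsbig_seq ?uniq_closed_nb// big_map.
pose g (d : nat * vertex) (u : vertex) : R := (s (unshift u d.2))%:R / (dom S u)%:R.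
rewrite (_ : \sum_(i <- _) _ =
    \sum_(u <- box_seq n) \sum_(d <- offsets) g d (shift u d.2)); last first.
  apply: eq_bigr => x _; rewrite shE /g.
  under [RHS]eq_bigr do rewrite shiftK.
  by rewrite -mulr_sumr; case: (s x); rewrite ?mul1r ?mul0r.
apply: le_trans (sum_offsets_shift_le n _) _.
  by move=> d z; rewrite /g divr_ge0 ?ler0n.
rewrite -sum1_size natr_sum; apply: ler_sum => u _.
rewrite /g -mulr_suml -natr_sum -dom_unshift divff// pnatr_eq0 -lt0n.
exact: dom_gt0.
Qed.

Lemma card_box n : Defs.card (S `&` box n) = count s (box_seq n).
Proof.
rewrite -size_filter; apply: card_eq_size; first by rewrite filter_uniq ?uniq_box_seq.
by move=> x; rewrite -mem_detectors.
Qed.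

(** At radius [n.+1] the detectors are bounded below through radius [n] and the shares above through
    radius [n.+2]. *)
Lemma share_mean_le n :
  share_mean R S n.+1 <= 38%:R / 15%:R + 61%:R / n.+1%:R.
Proof.
have sqE k : (size (box_seq k))%:R = (2 * k%:R + 1) ^+ 2 :> R.
  by rewrite size_box_seq natrX -addn1 -muln2 natrD natrM mulrC.
rewrite /share_mean card_box -[n.+1%:R]natr1; apply: mean_le_of_bounds.
- exact: ler0n.
- by rewrite -sqE; exact: box_le_detectors.
- apply: le_trans (sum_share_le n.+1) _; rewrite sqE -[n.+2%:R]natr1 -[n.+1%:R]natr1.
  by rewrite le_eqVlt; apply/orP; left; apply/eqP; ring.
Qed.

End Counting.

(** * Passage to the limit superior *)

Theorem theorem5 (R : realType) (S : set vertex) (hS : err_ld S) :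
  (average_share R S <= ((38%:R / 15%:R)%R : R)%:E)%E.
Proof.
rewrite /average_share; apply/lee_addgt0Pr => e e0.
(* Past this index the boundary term is at most [e]; the tail starting at [N.+1] also avoids radius
   0. *)
pose N := Num.truncn (61 / e).
apply: (@le_trans _ _ (ereal_sup
    ((fun n => (share_mean R S n)%:E) @` [set n | (N.+1 <= n)%N]))).
  by apply: ereal_inf_lbound; exists [set n | (N.+1 <= n)%N] => //; exists N.+1.
apply: ge_ereal_sup => _ [[|n] //= Nn <-].
rewrite -EFinD lee_fin; apply: le_trans (share_mean_le R hS n) _.
rewrite lerD2l ler_pdivrMr ?ltr0n// -ler_pdivrMl// mulrC.
apply: ltW; apply: lt_le_trans (truncnS_gt _) _.
by rewrite ler_nat.
Qed.
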